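(* Let $\mathscr{A}$ be a unital $C^*$-algebra and let $\mathscr{A}_1,\mathscr{A}_2\subseteq\mathscr{A}$ be unital $C^*$-subalgebras such that $\mathscr{A},\mathscr{A}_1,\mathscr{A}_2$ all have the same unit. Then the following statements are equivalent: (1) $\mathscr{A}_1$ and $\mathscr{A}_2$ are module independent in $\mathscr{A}$. (2) For each pair of states $\varphi_1\in S(\mathscr{A}_1)$ and $\varphi_2\in S(\mathscr{A}_2)$ there is a state $\varphi\in S(\mathscr{A})$ with $\mathscr{N}_{\varphi|\mathscr{A}_1}=\mathscr{N}_{\varphi_1}$ and $\mathscr{N}_{\varphi|\mathscr{A}_2}=\mathscr{N}_{\varphi_2}$. (3) $\mathscr{A}_1$ and $\mathscr{A}_2$ are $C^*$-independent.
   Context: A state on a $C^*$-algebra is a positive linear functional of norm one; $S(\mathscr{B})$ is the set of states of $\mathscr{B}$. For an element $x$ of a $C^*$-algebra, $|x|=(x^*x)^{1/2}$. For a state $\psi$ on a $C^*$-algebra $\mathscr{B}$, its left kernel is $\mathscr{N}_\psi=\{x\in\mathscr{B}:\psi(x^*x)=0\}$; $\varphi|\mathscr{B}$ denotes the restriction of $\varphi$ to a subalgebra $\mathscr{B}$. Module independence of $C^*$-subalgebras: unital $C^*$-subalgebras $\mathscr{A}_1,\mathscr{A}_2$ of a unital $C^*$-algebra $\mathscr{A}$ are module independent if there are constants $m,M>0$ such that for every pair of states $\varphi_1\in S(\mathscr{A}_1)$, $\varphi_2\in S(\mathscr{A}_2)$ there is a state $\varphi\in S(\mathscr{A})$ with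 $m\,\varphi_i(|x|)\le\varphi(|x|)\le M\,\varphi_i(|x|^2)^{1/2}$ for all $x\in\mathscr{A}_i$, $i=1,2$. $C^*$-independence: $C^*$-subalgebras $\mathscr{A}_1,\mathscr{A}_2$ of $\mathscr{A}$ (all with the same identity) are $C^*$-independent if for every state $\varphi_1$ of $\mathscr{A}_1$ and every state $\varphi_2$ of $\mathscr{A}_2$ there is a state $\varphi$ of $\mathscr{A}$ extending both $\varphi_1$ and $\varphi_2$. *)

(* Defs.v *)
From HB Require Import structures.
From mathcomp Require Import all_boot all_order all_algebra.
From mathcomp Require Import all_classical all_reals all_analysis.
From mathcomp Require Export complex.

Set Implicit Arguments.
Unset Strict Implicit.
Unset Printing Implicit Defensive.

Import Order.TTheory GRing.Theory Num.Theory.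
Import numFieldNormedType.Exports.

Local Open Scope classical_set_scope.
Local Open Scope complex_scope.
Local Open Scope ring_scope.

(* Norms on a normed module over the complex field [R[i]] take values in
   [R[i]]; there, [0 <= z] and [0 < z] mean in particular that [z] is real.

   The multiplication is given by raw fields because Hierarchy Builder rejects
   the join of the ring and normed-module structures: their existing join,
   [numDomainType], is commutative. The [algType] structure is recovered by the
   instances that follow. *)
HB.mixin Record isCStarAlgebra (R : realType) A
    of CompleteNormedModule R[i] A := {
  cstar_one : A;
  cstar_mul : A -> A -> A;
  star : A -> A;
  cstar_mulA : associative cstar_mul;
  cstar_mul1 : left_id cstar_one cstar_mul;
  cstar_mulr1 : right_id cstar_one cstar_mul;
  cstar_mulDl : left_distributive cstar_mul +%R;
  cstar_mulDr : right_distributive cstar_mul +%R;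
  cstar_one_neq0 : cstar_one != 0;
  cstar_scaleAl : forall (a : R[i]) (x y : A),
    a *: cstar_mul x y = cstar_mul (a *: x) y;
  cstar_scaleAr : forall (a : R[i]) (x y : A),
    a *: cstar_mul x y = cstar_mul x (a *: y);
  ler_norm_cstar_mul : forall x y : A, `|cstar_mul x y| <= `|x| * `|y|;
  starK : involutive star;
  starD : {morph star : x y / x + y};
  starZ : forall (a : R[i]) (x : A), star (a *: x) = a^* *: star x;
  star_mul : forall x y : A,
    star (cstar_mul x y) = cstar_mul (star y) (star x);
  cstar_identity : forall x : A, `|cstar_mul (star x) x| = `|x| ^+ 2;
}.

#[short(type="cstarAlgType")]
HB.structure Definition CStarAlgebra (R : realType) :=
  {A of isCStarAlgebra R A & CompleteNormedModule R[i] A}.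

Section CStarAlgebraAlgType.
Variables (R : realType) (A : cstarAlgType R).

#[export, non_forgetful_inheritance]
HB.instance Definition _ := GRing.Zmodule_isNzRing.Build A
  cstar_mulA cstar_mul1 cstar_mulr1 cstar_mulDl cstar_mulDr cstar_one_neq0.
#[export, non_forgetful_inheritance]
HB.instance Definition _ :=
  GRing.Lmodule_isLalgebra.Build R[i] A cstar_scaleAl.
#[export, non_forgetful_inheritance]
HB.instance Definition _ :=
  GRing.Lalgebra_isAlgebra.Build R[i] A cstar_scaleAr.

Lemma starM (x y : A) : star (x * y) = star y * star x.
Proof. exact: star_mul. Qed.

Lemma ler_normM_cstar (x y : A) : `|x * y| <= `|x| * `|y|.
Proof. exact: ler_norm_cstar_mul. Qed.

Lemma norm_star_mul (x : A) : `|star x * x| = `|x| ^+ 2.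
Proof. exact: cstar_identity. Qed.

End CStarAlgebraAlgType.

(* A subalgebra is a set [S] of elements of the ambient algebra [A].  A
   functional on [S] is a total function [A -> R[i]] of which only the values
   on [S] are ever constrained or used, so that the restriction to [S] of a
   functional [f] on [A] is [f] itself, read on [S]; functionals on [A] are the
   case [S = setT]. *)
Section CStarAlgebraTheory.
Context {R : realType} {A : cstarAlgType R}.
Implicit Types (S : set A) (f : A -> R[i]) (x p : A).

Definition unital_cstar_subalgebra S : Prop :=
  [/\ GRing.subalg_closed (mem S),
      forall x, S x -> S (star x)
    & closed S].

Definition positive_elt p : Prop := exists y : A, p = star y * y.

(* |x| = (x^* x)^(1/2), the unique positive square root of x^* x; it lies in
   every C*-subalgebra containing x. *)
Definition cstar_abs x : A :=
  xget 0 [set p | positive_elt p /\ p ^+ 2 = star x * x].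

Definition linear_on S f : Prop :=
  forall (a : R[i]) x y, S x -> S y -> f (a *: x + y) = a * f x + f y.

Definition positive_on S f : Prop := forall x, S x -> 0 <= f (star x * x).

Definition functional_norm S f : \bar R :=
  ereal_sup [set (complex.Re `|f x|)%:E | x in [set x | S x /\ `|x| <= 1]].

Definition is_state S f : Prop :=
  [/\ linear_on S f, positive_on S f & functional_norm S f = 1%E].

Definition left_kernel S f : set A := [set x | S x /\ f (star x * x) = 0].

Definition module_independent (A1 A2 : set A) : Prop :=
  exists m M : R, [/\ 0 < m, 0 < M &
    forall f1 f2, is_state A1 f1 -> is_state A2 f2 ->
    exists f, [/\ is_state setT f,
      forall x, A1 x ->
        m%:C * f1 (cstar_abs x) <= f (cstar_abs x)
                                <= M%:C * sqrtC (f1 (cstar_abs x ^+ 2))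
    & forall x, A2 x ->
        m%:C * f2 (cstar_abs x) <= f (cstar_abs x)
                                <= M%:C * sqrtC (f2 (cstar_abs x ^+ 2))]].

Definition cstar_independent (A1 A2 : set A) : Prop :=
  forall f1 f2, is_state A1 f1 -> is_state A2 f2 ->
  exists f, [/\ is_state setT f,
    {in A1, f =1 f1} & {in A2, f =1 f2}].

End CStarAlgebraTheory.

(* Main.v *)
(* The implication (2) -> (3) avoids pure states.  By Hahn-Banach, states [f1]
   and [f2] have a common extension as soon as [f1 a + f2 b <= t] whenever
   [a + b <= t] with [a], [b] self-adjoint in the two subalgebras.  Let [mu]
   and [nu] be the maxima of the spectra of [a] and [b], and choose states
   [g1], [g2] attaining them.  Then [mu - a = z^2] with [z] in the left kernel of [g1], so
   the state [f] given by (2) for [g1] and [g2] satisfies [f a = mu], likewise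
   [f b = nu], and [f1 a + f2 b <= mu + nu = f (a + b) <= t].
   (1) -> (2) and (3) -> (1) only use [f p ^ 2 <= f (p ^ 2) <= |p| f p] for a
   state [f] and a positive element [p].
   Positivity is developed from norms alone, without the spectrum: [a] is
   positive when it is self-adjoint and [| |a| - a | <= |a|].  Square roots come
   from an iteration for [sqrt (1 - b)], [|b| <= 1]. *)
Require Import Defs.
From mathcomp Require Import all_boot all_order all_algebra.
From mathcomp Require Import all_classical all_reals all_analysis.
From mathcomp Require Import ring lra.

Set Implicit Arguments.
Unset Strict Implicit.
Unset Printing Implicit Defensive.

Import Order.TTheory GRing.Theory Num.Theory.
Import numFieldNormedType.Exports.

Local Open Scope classical_set_scope.
Local Open Scope complex_scope.
Local Open Scope ring_scope.

Section CStarAlgebraStates.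
Variables (R : realType) (A : cstarAlgType R).
Implicit Types (x y z a b c : A) (r s t : R) (S : set A).

(** * The real-valued norm *)

Definition nm x : R := complex.Re `|x|.

Lemma nmE x : `|x| = (nm x)%:C.
Proof.
rewrite /nm; case: `|x| (normr_ge0 x) => u v.
by rewrite lecE /= => /andP[/eqP-> _].
Qed.

Lemma nm_ge0 x : 0 <= nm x.
Proof. by rewrite -lecR -nmE normr_ge0. Qed.

Lemma nm_eq0 x : nm x = 0 -> x = 0.
Proof. by move=> x0; apply: normr0_eq0; rewrite nmE x0. Qed.

Lemma nm0 : nm 0 = 0.
Proof. by rewrite /nm normr0. Qed.

Lemma nmD x y : nm (x + y) <= nm x + nm y.
Proof. by rewrite -lecR rmorphD /= -!nmE ler_normD. Qed.

Lemma nmN x : nm (- x) = nm x.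
Proof. by rewrite /nm normrN. Qed.

Lemma nmB x y : nm (x - y) <= nm x + nm y.
Proof. by rewrite -(nmN y) nmD. Qed.

Lemma nm_distC x y : nm (x - y) = nm (y - x).
Proof. by rewrite -nmN opprB. Qed.

Lemma nmM x y : nm (x * y) <= nm x * nm y.
Proof. by rewrite -lecR rmorphM /= -!nmE ler_normM_cstar. Qed.

Lemma normcR r : `|r%:C| = `|r|%:C :> R[i].
Proof. by rewrite normc_def /= expr0n addr0 sqrtr_sqr. Qed.

Lemma nmZ r x : nm (r%:C *: x) = `|r| * nm x.
Proof. by apply: complexI; rewrite -nmE normrZ normcR rmorphM /= nmE. Qed.

Lemma nmZ_ge0 r x : 0 <= r -> nm (r%:C *: x) = r * nm x.
Proof. by move=> r0; rewrite nmZ ger0_norm. Qed.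

Lemma nm_starM x : nm (star x * x) = nm x ^+ 2.
Proof. by apply: complexI; rewrite -nmE norm_star_mul nmE rmorphXn. Qed.

(** The C*-identity gives [nm y ^+ 2 <= nm (star y) * nm y]; cancelling a factor bounds [y] by
    [star y], and the involution gives the reverse. *)
Lemma nm_star x : nm (star x) = nm x.
Proof.
suff le_star y : nm y <= nm (star y).
  by apply/eqP; rewrite eq_le le_star -{2}(starK x) le_star.
have [->|y0] := eqVneq (nm y) 0; first exact: nm_ge0.
have ygt0 : 0 < nm y by rewrite lt_def y0 nm_ge0.
by rewrite -(ler_pM2r ygt0) -expr2 -nm_starM nmM.
Qed.

Lemma star0 : star (0 : A) = 0.
Proof. by have := starZ 0 (0 : A); rewrite scale0r conjC0 scale0r. Qed.

Lemma star1 : star (1 : A) = 1.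
Proof. by rewrite -[RHS]starK -[star 1]mul1r starM starK mul1r. Qed.

Lemma starN x : star (- x) = - star x.
Proof. by rewrite -scaleN1r starZ rmorphN1 scaleN1r. Qed.

Lemma starB x y : star (x - y) = star x - star y.
Proof. by rewrite starD starN. Qed.

Lemma conjcR r : (r%:C)^* = r%:C :> R[i].
Proof. exact: conjc_real. Qed.

Lemma starZR r x : star (r%:C *: x) = r%:C *: star x.
Proof. by rewrite starZ conjcR. Qed.

Lemma starZi x : star ('i%C *: x) = - ('i%C *: star x).
Proof.
have conji : ('i%C)^* = - 'i%C :> R[i] by exact: conjCi.
by rewrite starZ conji scaleNr.
Qed.

Lemma nm1 : nm 1 = 1.
Proof.
have nz : nm 1 != 0 by apply/eqP => /nm_eq0/eqP; rewrite oner_eq0.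
by apply: (mulIf nz); rewrite -expr2 -nm_starM star1 !mul1r.
Qed.


(* Additive maps bounded by a multiple of the norm: enough continuity to pass
   algebraic identities to limits. *)
Lemma lim_kernel (phi : A -> A) (K : R) (u : nat -> A) (l : A) :
  {morph phi : x y / x - y} -> (forall x, nm (phi x) <= K * nm x) ->
  (forall e : R, 0 < e ->
     exists N, forall n, (N <= n)%N -> nm (u n - l) <= e) ->
  (forall n, phi (u n) = 0) -> phi l = 0.
Proof.
move=> phiB phiK ul u0; apply: nm_eq0; apply/eqP; rewrite eq_le nm_ge0 andbT.
apply/ler_addgt0Pl => e e0; rewrite addr0.
have K1 : 0 < `|K| + 1 by rewrite ltr_pwDr.
have [N uN] := ul (e / (`|K| + 1)) (divr_gt0 e0 K1).
have := uN N (leqnn _); rewrite ler_pdivlMr // => le_e.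
have -> : phi l = - phi (u N - l) by rewrite phiB u0 sub0r opprK.
rewrite nmN (le_trans (phiK _)) // (le_trans _ le_e) // mulrC.
by rewrite ler_wpM2l ?nm_ge0 // (le_trans (ler_norm K)) // lerDl.
Qed.

(** The scalar sequence [t] is nondecreasing and bounded, so [u] is Cauchy. Both forms of
    convergence are kept: the topological one serves closed subalgebras, the epsilon one serves
    [lim_kernel]. *)
Lemma nm_complete (u : nat -> A) (t : nat -> R) (T : R) :
  (forall n, t n <= T) ->
  (forall m n, (m <= n)%N -> nm (u n - u m) <= t n - t m) ->
  exists l, (u @ \oo --> l) /\
    forall e : R, 0 < e -> exists N, forall n, (N <= n)%N -> nm (u n - l) <= e.
Proof.
move=> tT ut.
have supt : has_sup (range t).
  by split; [exists (t 0%N), 0%N | exists T => _ [n _ <-]].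
have tail (e : R) : 0 < e ->
    exists N, forall n, (N <= n)%N -> nm (u n - u N) < e.
  move=> e0; have [_ [N _ <-] ltN] := sup_adherent e0 supt.
  exists N => n leNn; rewrite (le_lt_trans (ut _ _ leNn)) //.
  rewrite ltrBlDl -ltrBlDr (le_lt_trans _ ltN) // lerB //.
  by apply: ub_le_sup; [case: supt | exists n].
have cu : cvg (u @ \oo).
  apply: cauchy_cvg; apply: cauchy_exP => e e0.
  (* Radii of balls live in [R[i]]; a positive one is real. *)
  have [eI er0] : e = (complex.Re e)%:C /\ 0 < complex.Re e.
    by case: e e0 => a b; rewrite ltcE /= => /andP[/eqP-> ->].
  have [N uN] := tail _ er0; exists (u N); exists N => // n /= leNn.
  by rewrite -ball_normE /ball_ /= distrC nmE eI ltcR uN.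
exists (lim (u @ \oo)); split => // e e0.
have e0C : (0 : R[i]) < e%:C by rewrite ltcR.
have /cvg_ballP/(_ _ e0C)[N _ uN] := cu; exists N => n leNn.
have := uN n leNn; rewrite -ball_normE /ball_ /= distrC nmE ltcR => /ltW; exact.
Qed.

(** * Square roots *)

Section Subalgebra.
Variable S : set A.
Hypothesis hS : unital_cstar_subalgebra S.

Lemma csub1 : S 1.
Proof. by have [[]] := hS; rewrite inE. Qed.

Lemma csubL (k : R[i]) x y : S x -> S y -> S (k *: x + y).
Proof. by have [[_ + _] _ _] := hS => /(_ k x y); rewrite !inE; apply. Qed.

Lemma csubM x y : S x -> S y -> S (x * y).
Proof. by have [[_ _ +] _ _] := hS => /(_ x y); rewrite !inE; apply. Qed.

Lemma csub_star x : S x -> S (star x).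
Proof. by have [_ + _] := hS; apply. Qed.

Lemma csubD x y : S x -> S y -> S (x + y).
Proof. by move=> Sx Sy; rewrite -[x]scale1r; apply: csubL. Qed.

Lemma csub0 : S 0.
Proof. by rewrite -(addNr 1) -scaleN1r; apply: csubL; apply: csub1. Qed.

Lemma csubZ (k : R[i]) x : S x -> S (k *: x).
Proof.
by move=> Sx; rewrite -[_ *: x]addr0; apply: csubL => //; apply: csub0.
Qed.

Lemma csubB x y : S x -> S y -> S (x - y).
Proof. by move=> Sx Sy; rewrite addrC -scaleN1r; apply: csubL. Qed.

Lemma csubA (k : R[i]) : S k%:A.
Proof. exact/csubZ/csub1. Qed.

End Subalgebra.

Lemma unital_cstar_subalgebraT : unital_cstar_subalgebra [set: A].
Proof.
by split=> //; split=> [|k x y _ _|x y _ _]; rewrite in_setT.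
Qed.

(** * Self-adjoint elements and real scalars *)

Definition sa x := star x = x.

Lemma saM x y : sa x -> sa y -> x * y = y * x -> sa (x * y).
Proof. by rewrite /sa starM => -> -> ->. Qed.

Lemma saD x y : sa x -> sa y -> sa (x + y).
Proof. by rewrite /sa starD => -> ->. Qed.

Lemma saN x : sa x -> sa (- x).
Proof. by rewrite /sa starN => ->. Qed.

Lemma saB x y : sa x -> sa y -> sa (x - y).
Proof. by move=> sx sy; apply: saD => //; apply: saN. Qed.

Lemma saZ r x : sa x -> sa (r%:C *: x).
Proof. by rewrite /sa starZR => ->. Qed.

Lemma sa1 : sa 1.
Proof. exact: star1. Qed.

Lemma sa0 : sa 0.
Proof. exact: star0. Qed.

Lemma saA r : sa (r%:C%:A).
Proof. exact/saZ/sa1. Qed.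

Lemma sa_starM x : sa (star x * x).
Proof. by rewrite /sa starM starK. Qed.

Lemma nm_sa_sq x : sa x -> nm (x * x) = nm x ^+ 2.
Proof. by move=> sx; rewrite -nm_starM sx. Qed.

Lemma sa_sq_eq0 x : sa x -> x * x = 0 -> x = 0.
Proof.
move=> sx xx; apply: nm_eq0; apply/eqP.
by rewrite -[_ == 0]andTb -(expf_eq0 (nm x) 2) -nm_sa_sq // xx nm0.
Qed.

Lemma commA c r : c * r%:C%:A = r%:C%:A * c.
Proof. by rewrite -scalerAr -scalerAl mulr1 mul1r. Qed.

Lemma nmA r : nm (r%:C%:A : A) = `|r|.
Proof. by rewrite nmZ nm1 mulr1. Qed.

Lemma scaleCD r s x : (r + s)%:C *: x = r%:C *: x + s%:C *: x.
Proof. by rewrite rmorphD scalerDl. Qed.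

Lemma scaleCA r s x : r%:C *: (s%:C *: x) = (r * s)%:C *: x.
Proof. by rewrite scalerA rmorphM. Qed.

Lemma scale2C x : 2%:C *: x = x + x.
Proof. by rewrite scaleCD scale1r. Qed.

(* The fixed point of [y |-> (b + y^2) / 2] is [1 - sqrt (1 - b)]; the scalar
   iteration with [b = 1] majorizes the increments. *)
Fixpoint sqrt_iter b n : A :=
  if n is m.+1 then (2^-1)%:C *: (b + sqrt_iter b m * sqrt_iter b m) else 0.

Fixpoint sqrt_bound n : R :=
  if n is m.+1 then 2^-1 * (1 + sqrt_bound m * sqrt_bound m) else 0.

Lemma sqrt_iterS b n : sqrt_iter b n.+1 =
  (2^-1)%:C *: (b + sqrt_iter b n * sqrt_iter b n).
Proof. by []. Qed.

Lemma sqrt_boundS n :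
  sqrt_bound n.+1 = 2^-1 * (1 + sqrt_bound n * sqrt_bound n).
Proof. by []. Qed.

Lemma sqrt_bound_itv n : 0 <= sqrt_bound n <= 1.
Proof. by elim: n => [|n /andP[t0 t1]] /=; apply/andP; split; nra. Qed.

Lemma sqrt_iter_comm b c n : c * b = b * c ->
  c * sqrt_iter b n = sqrt_iter b n * c.
Proof.
move=> cb; elim: n => [|n IHn] /=; first by rewrite mulr0 mul0r.
by rewrite -scalerAr -scalerAl mulrDr mulrDl cb mulrA IHn -mulrA IHn mulrA.
Qed.

Lemma sqrt_iter_sa b n : sa b -> sa (sqrt_iter b n).
Proof.
move=> sb; elim: n => [|n IHn] /=; first exact: sa0.
by apply: saZ; apply: saD => //; apply: saM.
Qed.

Lemma sqrt_iter_sub S b n : unital_cstar_subalgebra S -> S b ->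
  S (sqrt_iter b n).
Proof.
move=> hS Sb; elim: n => [|n IHn] /=; first exact: csub0.
by apply: csubZ => //; apply: csubD => //; apply: csubM.
Qed.

Lemma nm_sqrt_iter b n : nm b <= 1 -> nm (sqrt_iter b n) <= sqrt_bound n.
Proof.
move=> b1; elim: n => [|n IHn] /=; first by rewrite nm0.
rewrite nmZ_ge0 // ler_wpM2l // (le_trans (nmD _ _)) // lerD //.
by rewrite (le_trans (nmM _ _)) // ler_pM ?nm_ge0.
Qed.

(** Since the iterates commute, a difference of squares makes each increment half the product of the
    previous increment and a sum. The scalar increments factor the same way, so the bounds compare
    factor by factor. *)
Lemma nm_sqrt_iter_incr b n : nm b <= 1 ->
  nm (sqrt_iter b n.+1 - sqrt_iter b n) <= sqrt_bound n.+1 - sqrt_bound n.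
Proof.
move=> b1; elim: n => [|n IHn].
  rewrite /= !mulr0 !addr0 !subr0 mulr1 nmZ_ge0 //.
  by rewrite -[leRHS]mulr1 ler_wpM2l.
have -> : sqrt_iter b n.+2 - sqrt_iter b n.+1 = (2^-1)%:C *:
    ((sqrt_iter b n.+1 - sqrt_iter b n) * (sqrt_iter b n.+1 + sqrt_iter b n)).
  have yy : sqrt_iter b n * sqrt_iter b n.+1 = sqrt_iter b n.+1 * sqrt_iter b n.
    exact/sqrt_iter_comm/esym/sqrt_iter_comm.
  rewrite (sqrt_iterS b n.+1) {3}sqrt_iterS.
  rewrite -scalerBr; congr (_ *: _).
  by rewrite mulrDr !mulrBl yy addrA subrK opprD addrACA subrr add0r.
have -> : sqrt_bound n.+2 - sqrt_bound n.+1 = 2^-1 *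
    ((sqrt_bound n.+1 - sqrt_bound n) * (sqrt_bound n.+1 + sqrt_bound n)).
  by rewrite (sqrt_boundS n.+1) {3}sqrt_boundS; ring.
rewrite nmZ_ge0 // ler_wpM2l // (le_trans (nmM _ _)) // ler_pM ?nm_ge0 //.
by rewrite (le_trans (nmD _ _)) // lerD // nm_sqrt_iter.
Qed.

Lemma nm_sqrt_iter_le b m n : nm b <= 1 -> (m <= n)%N ->
  nm (sqrt_iter b n - sqrt_iter b m) <= sqrt_bound n - sqrt_bound m.
Proof.
move=> b1 /subnK<-; elim: (n - m)%N => [|k IHk]; first by rewrite !subrr nm0.
rewrite addSn -(subrK (sqrt_iter b (k + m)) (sqrt_iter b _.+1)) -addrA.
rewrite -(subrK (sqrt_bound (k + m)) (sqrt_bound _.+1)) -(addrA (_ - _)).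
by rewrite (le_trans (nmD _ _)) // lerD // nm_sqrt_iter_incr.
Qed.

(** The limit [l] of the iterates satisfies [2 l = b + l^2], that is [(1 - l)^2 = 1 - b], so
    [z = 1 - l]. Self-adjointness and commutation pass to the limit by [lim_kernel], membership in
    [S] by closedness. *)
Lemma sqrt_one_sub S b : unital_cstar_subalgebra S -> S b -> sa b ->
    nm b <= 1 ->
  exists z, [/\ S z, sa z, z * z = 1 - b, nm (1 - z) <= 1 &
    forall c, c * b = b * c -> c * z = z * c].
Proof.
move=> hS Sb sb b1; pose y := sqrt_iter b.
have [l [yl lim_l]] := nm_complete (fun n => proj2 (andP (sqrt_bound_itv n)))
  (fun m n => @nm_sqrt_iter_le b m n b1).
have Sl : S l.
  have [_ _ clS] := hS; move: yl; apply: closed_cvg => //.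
  by apply: nearW => n; apply: sqrt_iter_sub.
have sl : sa l.
  apply/subr0_eq.
  apply: (lim_kernel (phi := fun x => star x - x) (K := 2)) lim_l _.
  - by move=> x z; rewrite starB !opprB addrACA [RHS]addrACA [- _ - _]addrC.
  - move=> x; rewrite (le_trans (nmB _ _)) // nm_star.
    by rewrite mulrDl !mul1r.
  - by move=> n; apply/eqP; rewrite subr_eq0; apply/eqP/sqrt_iter_sa.
have cl c : c * b = b * c -> c * l = l * c.
  move=> cb; apply/subr0_eq.
  apply: (lim_kernel (phi := fun x => c * x - x * c) (K := 2 * nm c)) lim_l _.
  - move=> x z; rewrite mulrBr mulrBl !opprB addrACA [RHS]addrACA.
    by rewrite [- _ - _]addrC.
  - move=> x; rewrite (le_trans (nmB _ _)) //.
    have := nmM c x; have := nmM x c; lra.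
  - by move=> n; rewrite sqrt_iter_comm ?subrr.
have y1 n : nm (y n) <= 1.
  by rewrite (le_trans (nm_sqrt_iter _ b1)) //; case/andP: (sqrt_bound_itv n).
have l1 : nm l <= 1.
  apply/ler_addgt0Pl => e /lim_l[N /(_ N (leqnn _)) ne].
  rewrite -(subrK (y N) l) (le_trans (nmD _ _)) // lerD //.
  by rewrite nm_distC.
have eql : 2%:C *: l - b - l * l = 0.
  apply: nm_eq0; apply/eqP; rewrite eq_le nm_ge0 andbT.
  apply/ler_addgt0Pl => e e0; rewrite addr0.
  (* The defect splits into three terms of norm at most [e / 2], [e / 4] and [e / 4]. *)
  have [|N yN] := lim_l (e / 4); first by rewrite divr_gt0.
  have -> : 2%:C *: l - b - l * l =
      2%:C *: (l - y N.+1) + ((y N - l) * y N + l * (y N - l)).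
    have -> : (y N - l) * y N + l * (y N - l) = y N * y N - l * l.
      by rewrite mulrBl mulrBr addrA subrK.
    have -> : 2%:C *: (l - y N.+1) = 2%:C *: l - b - y N * y N.
      by rewrite scalerBr /y sqrt_iterS scaleCA divff // scale1r opprD addrA.
    by rewrite addrA subrK.
  have h1 : nm (2%:C *: (l - y N.+1)) <= 2 * (e / 4).
    by rewrite nmZ_ge0 // ler_wpM2l // nm_distC yN.
  have h0 := yN N (leqnn _).
  have h2 : nm ((y N - l) * y N) <= e / 4 * 1.
    by rewrite (le_trans (nmM _ _)) // ler_pM ?nm_ge0.
  have h3 : nm (l * (y N - l)) <= 1 * (e / 4).
    by rewrite (le_trans (nmM _ _)) // ler_pM ?nm_ge0.
  apply: (le_trans (nmD _ _)); apply: (le_trans (lerD (lexx _) (nmD _ _))).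
  lra.
exists (1 - l); split.
- by apply: csubB => //; apply: csub1.
- by apply: saB => //; apply: sa1.
- have bE : b = l + (l - l * l).
    by rewrite addrA -scale2C -[b in LHS]add0r -eql addrAC subrK.
  by rewrite mulrBl !mulrBr !mul1r mulr1 bE [in RHS]opprD [in RHS]addrA.
- by rewrite opprB addrC subrK.
- by move=> c /cl cl'; rewrite mulrBr mulrBl cl' mulr1 mul1r.
Qed.

(** * Positive elements *)

Lemma mulii : 'i%C * 'i%C = -1 :> R[i].
Proof. by rewrite -expr2 sqr_i. Qed.

(* [u = w + i z] satisfies [star u * u = w^2 + z^2], and [w] is the real part of
   [u]. *)
Lemma nm_sum_sq w z : sa w -> sa z -> w * z = z * w ->
  nm w ^+ 2 <= nm (w * w + z * z).
Proof.
move=> sw sz wz; pose u := w + 'i%C *: z.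
have starE : star u = w - 'i%C *: z by rewrite starD starZi sw sz.
have uu : star u * u = w * w + z * z.
  rewrite starE mulrBl !mulrDr -!scalerAl -!scalerAr scalerA wz.
  rewrite opprD addrA addrK.
  by rewrite mulii scaleN1r opprK.
rewrite -uu nm_starM ler_sqr ?nnegrE ?nm_ge0 //.
have w2 : 2%:C *: w = u + star u.
  by rewrite starE /u addrACA subrr addr0 scale2C.
have := nmD u (star u); rewrite -w2 nm_star nmZ_ge0 //; lra.
Qed.

Lemma nm_subA t a : 0 < t ->
  nm (t%:C%:A - a) = t * nm (1 - (t^-1)%:C *: a).
Proof.
move=> t0; rewrite -nmZ_ge0 ?ltW // scalerBr scaleCA divff ?gt_eqF //.
by rewrite scale1r.
Qed.

(** Here [1 - z * z] is a square [w * w] with [w] commuting with [z], and [w * w + z * z = 1], so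
    [nm_sum_sq] bounds [w]. *)
Lemma nm_one_sub_sq z : sa z -> nm z <= 1 -> nm (1 - z * z) <= 1.
Proof.
move=> sz z1.
have zz1 : nm (z * z) <= 1 by rewrite nm_sa_sq // expr_le1 // nm_ge0.
have [//|w [_ sw ww _ comw]] :=
  sqrt_one_sub unital_cstar_subalgebraT _ (saM sz sz erefl) zz1.
rewrite -ww nm_sa_sq // (le_trans (nm_sum_sq sw sz _)) //.
  by apply/esym/comw; rewrite mulrA.
by rewrite ww subrK nm1.
Qed.

Definition psd a := sa a /\ nm ((nm a)%:C%:A - a) <= nm a.

Lemma psd_sa a : psd a -> sa a.
Proof. by case. Qed.

Lemma psd0 : psd 0.
Proof. by split; [exact: sa0 | rewrite nm0 scale0r subrr nm0]. Qed.

Lemma psd_sq z : sa z -> psd (z * z).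
Proof.
move=> sz; have [/nm_eq0->|z0] := eqVneq (nm z) 0.
  by rewrite mulr0; exact: psd0.
have zgt0 : 0 < nm z by rewrite lt_def z0 nm_ge0.
split; first exact: saM.
rewrite nm_sa_sq // nm_subA ?exprn_gt0 // ler_piMr ?sqr_ge0 //.
pose z' := ((nm z)^-1)%:C *: z.
have -> : (((nm z) ^+ 2)^-1)%:C *: (z * z) = z' * z'.
  by rewrite /z' -scalerAl -scalerAr scaleCA expr2 invfM.
apply: nm_one_sub_sq; first exact: saZ.
by rewrite nmZ_ge0 ?mulVf // invr_ge0 nm_ge0.
Qed.

(** Rescaling to [b = 1 - a / t] reduces this to [sqrt_one_sub]. The last clause places the root in
    a ball of the same kind, which later makes the root positive. *)
Lemma sqrt_ball S a t : unital_cstar_subalgebra S -> S a -> sa a -> 0 <= t ->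
    nm (t%:C%:A - a) <= t ->
  exists z, [/\ S z, sa z, z * z = a,
    forall c, c * a = a * c -> c * z = z * c
    & exists2 r, 0 <= r & nm (r%:C%:A - z) <= r].
Proof.
move=> hS Sa sa_a; rewrite le_eqVlt => /predU1P[<-|t0] le_t.
  have -> : a = 0.
    apply: nm_eq0; apply/eqP; rewrite eq_le nm_ge0 andbT.
    by rewrite -[a]opprK nmN -[- a]add0r; move: le_t; rewrite scale0r.
  exists 0; split; [exact: csub0 | exact: sa0 | by rewrite mulr0 | | ].
    by move=> c; rewrite mulr0.
  by exists 0 => //; rewrite scale0r subr0 nm0.
pose b := 1 - (t^-1)%:C *: a.
have [||| z [Sz sz zz z1 cz]] := @sqrt_one_sub S b hS.
- by apply: csubB => //; [exact: csub1 | exact: csubZ].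
- by apply: saB; [exact: sa1 | exact: saZ].
- by rewrite -(ler_pM2l t0) -nm_subA // mulr1.
have s0 : 0 <= Num.sqrt t by [].
exists ((Num.sqrt t)%:C *: z); split; [exact: csubZ | exact: saZ | | | ].
- rewrite -scalerAl -scalerAr scaleCA zz -expr2 sqr_sqrtr ?ltW //.
  by rewrite /b subKr scaleCA divff ?gt_eqF // scale1r.
- move=> c ca; rewrite -scalerAl -scalerAr cz // /b mulrBr mulrBl mulr1 mul1r.
  by rewrite -scalerAl -scalerAr ca.
- exists (Num.sqrt t) => //.
  by rewrite -scalerBr nmZ_ge0 // ler_piMr.
Qed.

(** Such an [a] is a square. The free radius [t] is what reduces the positivity of sums to the
    triangle inequality. *)
Lemma psd_ball a t : sa a -> 0 <= t -> nm (t%:C%:A - a) <= t -> psd a.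
Proof.
move=> sa_a t0 at_.
have [//|z [_ sz <- _ _]] :=
  sqrt_ball unital_cstar_subalgebraT _ sa_a t0 at_.
exact: psd_sq.
Qed.

Lemma psd_sqrt S a : unital_cstar_subalgebra S -> S a -> psd a ->
  exists z, [/\ S z, psd z, z * z = a &
    forall c, c * a = a * c -> c * z = z * c].
Proof.
move=> hS Sa [sa_a an].
have [z [Sz sz zz cz [r r0 zr]]] := sqrt_ball hS Sa sa_a (nm_ge0 a) an.
by exists z; split => //; apply: psd_ball zr.
Qed.

Lemma psd_sqrtT a : psd a ->
  exists z, [/\ psd z, z * z = a & forall c, c * a = a * c -> c * z = z * c].
Proof.
by case/(psd_sqrt unital_cstar_subalgebraT (I : setT a)) => z []; exists z.
Qed.

Lemma psdD a b : psd a -> psd b -> psd (a + b).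
Proof.
move=> [sa_a an] [sb bn]; apply: (@psd_ball _ (nm a + nm b)).
- exact: saD.
- by rewrite addr_ge0 ?nm_ge0.
- by rewrite scaleCD opprD addrACA (le_trans (nmD _ _)) // lerD.
Qed.

Lemma psdZ r a : 0 <= r -> psd a -> psd (r%:C *: a).
Proof.
move=> r0 [sa_a an]; apply: (@psd_ball _ (r * nm a)).
- exact: saZ.
- by rewrite mulr_ge0 ?nm_ge0.
- by rewrite -scaleCA -scalerBr nmZ_ge0 // ler_wpM2l.
Qed.

Lemma psd1 : psd 1.
Proof. by rewrite -[1]mulr1; apply/psd_sq/sa1. Qed.

Lemma psdA r : 0 <= r -> psd r%:C%:A.
Proof. by move=> r0; apply: psdZ => //; exact: psd1. Qed.

Lemma psd_ge_nm a t : sa a -> nm a <= t -> psd (t%:C%:A - a).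
Proof.
move=> sa_a le_at; apply: (@psd_ball _ t).
- by apply: saB => //; apply: saA.
- exact: le_trans (nm_ge0 a) le_at.
- by rewrite subKr.
Qed.

Lemma psd_nm_sub a t : psd a -> nm a <= t -> nm (t%:C%:A - a) <= t.
Proof.
move=> [_ an] le_at; rewrite -(subrK (nm a) t) scaleCD -addrA.
by rewrite (le_trans (nmD _ _)) // lerD // nmA ger0_norm ?subr_ge0.
Qed.

(** With [t = nm (a + b)], the element [t - a = (t - (a + b)) + b] is positive. Its root [w]
    commutes with the root [z] of [a], and [z^2 + w^2 = t], so [nm_sum_sq] bounds
    [nm z ^+ 2 = nm a]. *)
Lemma psd_nm_le a b : psd a -> psd b -> nm a <= nm (a + b).
Proof.
move=> pa pb; set t := nm (a + b).
have /psd_sqrtT[w [pw ww cw]] : psd (t%:C%:A - a).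
  have := psdD (psd_ge_nm (saD (psd_sa pa) (psd_sa pb)) (lexx t)) pb.
  by rewrite opprD addrA subrK.
have [z [pz zz cz]] := psd_sqrtT pa.
have zw : z * w = w * z.
  apply: cw; rewrite mulrBr mulrBl commA -zz mulrA //.
have := nm_sum_sq (psd_sa pz) (psd_sa pw) zw.
rewrite ww zz addrC subrK nmA ger0_norm ?nm_ge0 //.
by rewrite -nm_sa_sq ?zz //; apply: psd_sa.
Qed.

Lemma psd_anti a : psd a -> psd (- a) -> a = 0.
Proof.
move=> pa pNa; apply: nm_eq0; apply/eqP; rewrite eq_le nm_ge0 andbT.
by rewrite (le_trans (psd_nm_le pa pNa)) // subrr nm0.
Qed.

Lemma psdA_ge0 r : psd (r%:C%:A) -> 0 <= r.
Proof.
move=> pr; rewrite leNgt; apply/negP => r0.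
have := psd_anti pr; rewrite -scaleNr -rmorphN /= => /(_ (psdA _)).
rewrite oppr_ge0 (ltW r0) => /(_ isT)/(congr1 nm).
by rewrite nmA nm0 => /normr0P/eqP r00; rewrite r00 ltxx in r0.
Qed.

(** Each root commutes with whatever commutes with its square, so the two roots commute and [a * b]
    is the square of their product. *)
Lemma psdM a b : psd a -> psd b -> a * b = b * a -> psd (a * b).
Proof.
move=> pa pb ab.
have [z [pz zz cz]] := psd_sqrtT pa; have [w [pw ww cw]] := psd_sqrtT pb.
have bz : b * z = z * b by apply: cz.
have zw : z * w = w * z by apply: cw.
have -> : a * b = (z * w) * (z * w).
  by rewrite -zz -ww -!mulrA; congr (_ * _); rewrite mulrA zw -!mulrA zw.
by apply: psd_sq; apply: saM => //; apply: psd_sa.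
Qed.

(** Shifting both [a] and the radius by [e / 2] leaves the difference unchanged, so its norm is at
    most [nm a + e / 2]. *)
Lemma psd_closed a : sa a -> (forall e, 0 < e -> psd (a + e%:C%:A)) -> psd a.
Proof.
move=> sa_a pae; split => //; apply/ler_addgt0Pl => e e0.
have e2 : 0 < e / 2 by rewrite divr_gt0.
have ae : nm (a + (e / 2)%:C%:A) <= nm a + e / 2.
  by rewrite (le_trans (nmD _ _)) // nmA ger0_norm // ltW.
have := psd_nm_sub (pae _ e2) ae.
have -> : (nm a + e / 2)%:C%:A - (a + (e / 2)%:C%:A) = (nm a)%:C%:A - a.
  by rewrite scaleCD opprD addrACA subrr addr0.
lra.
Qed.

(* If [y' y = - k], where [y' = star y], then [(1 + k)^n y' = y' (1 - y y')^n],
   whose norm stays bounded, while [(1 + k)^n k >= n k^2]. *)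
Lemma star_mul_npsd_ball y k : nm y <= 1 -> psd k -> star y * y = - k -> k = 0.
Proof.
move=> y1 pk yyE.
(* Twice [y y' + y' y] is [(y + y')^2 + (i (y - y'))^2], a sum of squares of self-adjoint elements,
   and [y' y = - k]. *)
have yy_psd : psd (y * star y).
  have -> : y * star y = (2^-1)%:C *:
    ((y + star y) * (y + star y) +
      ('i%C *: (y - star y)) * ('i%C *: (y - star y)) + 2%:C *: k).
    have sq z : (y + z) * (y + z) = (y * y + z * z) + (y * z + z * y).
      by rewrite mulrDl !mulrDr [z * y + _]addrC addrACA.
    rewrite -scalerAl -scalerAr scalerA mulii scaleN1r !sq.
    rewrite mulrNN mulrN mulNr -opprD opprB [_ + _ + (_ - _)]addrC.
    rewrite addrA subrK scale2C addrACA yyE subrK.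
    by rewrite -scale2C scaleCA mulVf ?scale1r.
  apply: psdZ => //; apply: psdD; last exact: psdZ.
  apply: psdD; apply: psd_sq; first by rewrite /sa starD starK addrC.
  by rewrite /sa starZi starB starK -scalerN opprB.
pose g := 1 + k; pose h := 1 - y * star y.
have gy n : g ^+ n * star y = star y * h ^+ n.
  elim: n => [|n IHn]; first by rewrite !expr0 mul1r mulr1.
  rewrite exprSr -mulrA; have -> : g * star y = star y * h.
    rewrite /g /h mulrDl mulrBr mul1r mulr1 mulrA yyE mulNr opprK //.
  by rewrite mulrA IHn -mulrA -exprSr.
have h1 n : nm (h ^+ n) <= 1.
  elim: n => [|n IHn]; first by rewrite expr0 nm1.
  rewrite exprS (le_trans (nmM _ _)) // mulr_ile1 ?nm_ge0 //.
  have := @psd_nm_sub (y * star y) 1 yy_psd; rewrite scale1r; apply.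
  by rewrite (le_trans (nmM _ _)) // nm_star mulr_ile1 ?nm_ge0.
have gk n : nm (g ^+ n * k) <= 1.
  rewrite -[k]opprK -yyE mulrN nmN mulrA gy (le_trans (nmM _ _)) //.
  rewrite mulr_ile1 ?nm_ge0 // (le_trans (nmM _ _)) //.
  by rewrite nm_star mulr_ile1 ?nm_ge0.
have kg n : k * g ^+ n = g ^+ n * k.
  by apply: commrX; rewrite /GRing.comm /g mulrDr mulrDl mulr1 mul1r.
(* This feeds the induction for [(1 + k)^n k >= n k^2], whose increment is [((1 + k)^n - 1) k^2]. *)
have g1 n : psd (g ^+ n - 1).
  elim: n => [|n IHn]; first by rewrite expr0 subrr; exact: psd0.
  have -> : g ^+ n.+1 - 1 = (g ^+ n - 1) + ((g ^+ n - 1) * k + k).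
    by rewrite exprSr /g mulrDr mulr1 mulrBl mul1r subrK addrAC.
  apply: psdD => //; apply: psdD => //; apply: psdM => //.
  by rewrite mulrBr mulrBl kg mul1r mulr1.
have kk_psd : psd (k * k) by apply: psdM.
have gkn n : psd (g ^+ n * k - n%:R%:C *: (k * k)).
  elim: n => [|n IHn]; first by rewrite expr0 mul1r scale0r subr0.
  have -> : g ^+ n.+1 * k - n.+1%:R%:C *: (k * k) =
    (g ^+ n * k - n%:R%:C *: (k * k)) + (g ^+ n - 1) * (k * k).
    rewrite -natr1 scaleCD scale1r exprSr /g -mulrA mulrDl mul1r mulrDr.
    by rewrite mulrBl mul1r opprD addrACA.
  apply: psdD => //; apply: psdM => //.
  by rewrite mulrBr mulrBl mulr1 mul1r mulrA -kg -mulrA -kg mulrA.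
apply: (sa_sq_eq0 (psd_sa pk)); apply: nm_eq0; apply/eqP.
rewrite eq_le nm_ge0 andbT leNgt; apply/negP => kk0.
(* Monotonicity of the norm on positive elements turns the growth into a bound uniform in [n],
   against the Archimedean property. *)
have nk n : n%:R * nm (k * k) <= 1.
  rewrite -nmZ_ge0 // (le_trans _ (gk n)) //.
  have := psd_nm_le (psdZ (ler0n R n) kk_psd) (gkn n).
  by rewrite addrC subrK.
have [n ltn] : exists n, (nm (k * k))^-1 < n%:R.
  by exists (Num.truncn (nm (k * k))^-1).+1; rewrite truncnS_gt.
have := nk n; rewrite leNgt => /negP; apply.
by rewrite -ltr_pdivrMr // div1r.
Qed.

(** Scaling by [r] brings [y] into the unit ball and multiplies [k] by [r^2]. *)
Lemma star_mul_npsd y k : psd k -> star y * y = - k -> k = 0.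
Proof.
move=> pk yyE; pose r := (1 + nm y)^-1.
have r0 : 0 < r by rewrite invr_gt0 ltr_pwDl ?nm_ge0.
have : (r * r)%:C *: k = 0.
  apply: (@star_mul_npsd_ball (r%:C *: y)).
  - rewrite nmZ_ge0 ?(ltW r0) // /r mulrC ler_pdivrMr ?mul1r ?lerDr //.
    by rewrite ltr_pwDl ?nm_ge0.
  - by apply: psdZ => //; rewrite mulr_ge0 ?ltW.
  - by rewrite starZR -scalerAl -scalerAr scaleCA yyE scalerN.
by move/eqP; rewrite scaler_eq0 fmorph_eq0 mulf_eq0 orbb (gt_eqF r0) => /eqP.
Qed.

(* With [h = star x * x] and [g = |h|], the element [y = x (g - h)]
   satisfies [star y * y = - (g - h)^2 g], hence [(g - h) g = 0] and [h = g]. *)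
Lemma psd_star_mul x : psd (star x * x).
Proof.
set h := star x * x; have sh : sa h := sa_starM x.
have [g [pg gg cg]] := psd_sqrtT (psd_sq sh).
have hg : h * g = g * h by apply: cg; rewrite mulrA.
(* The root of [g] lets [(g - h)^2 g] be written as the square of the self-adjoint element
   [w * p]. *)
have [w [pw ww cw]] := psd_sqrtT pg.
have sg := psd_sa pg; have sw := psd_sa pw.
have hw : h * w = w * h by exact: cw.
have gw : g * w = w * g by exact: cw.
pose p := g - h; have sp : sa p by exact: saB.
have pw_comm : w * p = p * w by rewrite mulrBr mulrBl hw gw.
have pg_comm : p * g = g * p by rewrite mulrBr mulrBl hg.
have ph : h * p = - (g * p) by rewrite !mulrBr hg -gg opprB.
have swp : sa (w * p) by exact: saM.
have wpwp : (w * p) * (w * p) = p * (g * p).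
  by rewrite {1}pw_comm -mulrA [w * _]mulrA ww.
have wp0 : w * p = 0.
  apply: (sa_sq_eq0 swp); apply: (@star_mul_npsd (x * p)); first exact: psd_sq.
  by rewrite starM sp -mulrA [star x * _]mulrA -/h ph mulrN wpwp.
have gp0 : g * p = 0 by rewrite -ww -mulrA wp0 mulr0.
have : p = 0.
  apply: (sa_sq_eq0 sp); rewrite {1}/p mulrBl gp0 ph gp0 oppr0 subrr //.
by move=> /subr0_eq <-.
Qed.

(** Both are compared with the root [c] of [b^2] that commutes with everything commuting with [b^2].
    For another root [x] and [d = x - c], the positive elements [d^2 x] and [d^2 c] sum to
    [d (x^2 - c^2) = 0], so both vanish, and [d^4 = (d^2 x - d^2 c) d = 0]. *)
Lemma sq_psd_inj a b : psd a -> psd b -> a * a = b * b -> a = b.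
Proof.
move=> pa pb aabb.
have [c [pc cc comc]] := psd_sqrtT (psd_sq (psd_sa pb)).
suff uniq x : psd x -> x * x = b * b -> x = c by rewrite (uniq a) // (uniq b).
move=> {a pa aabb} px xx; pose d := x - c.
have cx : x * c = c * x by apply: comc; rewrite -xx mulrA.
have sd : sa d by apply: saB; exact: psd_sa.
have dx : d * x = x * d by rewrite mulrBl mulrBr cx.
have dc : d * c = c * d by rewrite mulrBl mulrBr cx.
have psd_dd y : psd y -> d * y = y * d -> psd ((d * d) * y).
  move=> py dy; apply: psdM => //; first exact: psd_sq.
  by rewrite -mulrA dy !mulrA dy.
have sum0 : (d * d) * x + (d * d) * c = 0.
  rewrite -mulrDr -mulrA; have -> : d * (x + c) = 0.
    by rewrite mulrDr /d !mulrBl cx addrA subrK xx cc subrr.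
  by rewrite mulr0.
have ddx : (d * d) * x = 0.
  apply: psd_anti; first exact: psd_dd.
  have := psd_dd c pc dc; rewrite -[_ * c](addKr ((d * d) * x)) sum0 addr0 //.
have ddc : (d * d) * c = 0 by move: sum0; rewrite ddx add0r.
apply: subr0_eq; apply: (sa_sq_eq0 sd); apply: sa_sq_eq0; first exact: saM.
have -> : (d * d) * (d * d) = ((d * d) * x - (d * d) * c) * d.
  by rewrite -mulrBr mulrA.
by rewrite ddx ddc subrr mul0r.
Qed.

(** * States *)

(** A root found inside [S] meets the condition in [xget], and uniqueness of positive roots
    identifies the chosen element with it. *)
Lemma cstar_absP S x : unital_cstar_subalgebra S -> S x ->
  [/\ S (cstar_abs x), psd (cstar_abs x) &
      cstar_abs x * cstar_abs x = star x * x].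
Proof.
move=> hS Sx.
have [z [Sz pz zz _]] :=
  psd_sqrt hS (csubM hS (csub_star hS Sx) Sx) (psd_star_mul x).
have [w [pw ww _]] := psd_sqrtT pz.
have : [set p : A | positive_elt p /\ p ^+ 2 = star x * x] (cstar_abs x).
  apply: (@xgetPex _ 0); exists z; split; last by rewrite expr2.
  by exists w; rewrite (psd_sa pw).
case=> -[y py]; rewrite expr2 => pp.
suff -> : cstar_abs x = z by [].
by apply: sq_psd_inj => //; [rewrite py; exact: psd_star_mul | rewrite pp].
Qed.

Section LinearOn.
Variables (S : set A) (f : A -> R[i]).
Hypotheses (hS : unital_cstar_subalgebra S) (fL : linear_on S f).

Lemma linear_on0 : f 0 = 0.
Proof.
have S0 := csub0 hS; have := fL 1 S0 S0.
by rewrite scale1r mul1r addr0 => /eqP; rewrite -subr_eq subrr => /eqP.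
Qed.

Lemma linear_onZ (k : R[i]) x : S x -> f (k *: x) = k * f x.
Proof.
by move=> Sx; have := fL k Sx (csub0 hS); rewrite linear_on0 !addr0.
Qed.

Lemma linear_onD x y : S x -> S y -> f (x + y) = f x + f y.
Proof. by move=> Sx Sy; have := fL 1 Sx Sy; rewrite scale1r mul1r. Qed.

Lemma linear_onB x y : S x -> S y -> f (x - y) = f x - f y.
Proof.
by move=> Sx Sy; have := fL (-1) Sy Sx; rewrite scaleN1r mulN1r ![- _ + _]addrC.
Qed.

End LinearOn.

Section PositiveOn.
Variables (S : set A) (f : A -> R[i]).
Hypotheses (hS : unital_cstar_subalgebra S).
Hypotheses (fL : linear_on S f) (fP : positive_on S f).

(** The root is taken inside [S], the only place where [f] is constrained. *)
Lemma positive_on_psd a : S a -> psd a -> 0 <= f a.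
Proof.
by move=> Sa /(psd_sqrt hS Sa)[z [Sz [sz _] <- _]]; rewrite -{1}sz fP.
Qed.

Lemma positive_on1 : 0 <= f 1.
Proof. by apply: positive_on_psd; [exact: csub1 | exact: psd1]. Qed.

(** Writing [a] as [nm a - (nm a - a)] makes it a difference of positive elements. *)
Lemma positive_on_sa a : S a -> sa a -> f a = (complex.Re (f a))%:C.
Proof.
move=> Sa sa_a; rewrite RRe_real //.
rewrite -[a](subKr (nm a)%:C%:A) (linear_onB fL); first last.
- by apply: csubB => //; exact: csubA.
- exact: csubA.
rewrite rpredB // ger0_real // positive_on_psd //.
- exact: csubA.
- by apply: psdA; exact: nm_ge0.
- by apply: csubB => //; exact: csubA.
- exact: psd_ge_nm.
Qed.

(** [f] is real on the self-adjoint elements [x + star x] and [i (x - star x)]. *)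
Lemma positive_on_star x : S x -> f (star x) = conjc (f x).
Proof.
move=> Sx; have Sx' := csub_star hS Sx.
have h1 : complex.Im (f x + f (star x)) = 0.
  rewrite -(linear_onD fL) // (@positive_on_sa (x + star x)) //.
    exact: csubD.
  by rewrite /sa starD starK addrC.
have h2 : complex.Im ('i%C * (f x - f (star x))) = 0.
  rewrite -(linear_onB fL) // -(linear_onZ hS fL); last exact: csubB.
  rewrite (@positive_on_sa (_ *: _)) //.
    by apply: csubZ => //; exact: csubB.
  by rewrite /sa starZi starB starK -scalerN opprB.
move: h1 h2; case: (f x) => p q; case: (f (star x)) => p' q' /=.
rewrite !mul0r add0r !mul1r => h1 /subr0_eq ->.
by congr Complex; apply/eqP; rewrite -addr_eq0 addrC h1.
Qed.

(** A phase [u] turns [x] into [y] with [f y] equal to the modulus of [f x]; then [f] is applied to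
    the positive element [2 - (y + star y)]. *)
Lemma positive_on_norm x : S x -> nm x <= 1 -> `|f x| <= f 1.
Proof.
move=> Sx x1; have [->|fx0] := eqVneq (f x) 0.
  by rewrite normr0 positive_on1.
pose u := `|f x| / f x; pose y := u *: x.
have Sy : S y by exact: csubZ.
have fy : f y = `|f x| by rewrite (linear_onZ hS fL) // mulfVK.
have y1 : nm y <= 1.
  by rewrite -lecR -nmE normrZ normrM normrV ?unitfE // normr_id divff
             ?normr_eq0 // mul1r nmE lecR.
have fy' : f (star y) = `|f x|.
  by rewrite positive_on_star // fy normc_def conjc_real.
have yy2 : psd (2%:C%:A - (y + star y)).
  apply: psd_ge_nm; first by rewrite /sa starD starK addrC.
  by rewrite (le_trans (nmD _ _)) // nm_star; lra.
have S1 := csub1 hS; have Sy' := csub_star hS Sy.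
have := positive_on_psd _ yy2.
rewrite (linear_onB fL) ?(linear_onZ hS fL) ?(linear_onD fL) //; first last.
- exact: csubD.
- exact: csubZ.
move=> /(_ (csubB hS (csubZ hS _ S1) (csubD hS Sy Sy'))).
rewrite fy fy' subr_ge0 -mulr2n rmorph_nat mulr_natl. by rewrite lerMn2r.
Qed.

End PositiveOn.

(** By [positive_on_norm] the supremum over the unit ball is attained at [1], so norm one becomes an
    equation that restricts and extends easily. *)
Lemma is_stateP S f : unital_cstar_subalgebra S ->
  is_state S f <-> [/\ linear_on S f, positive_on S f & f 1 = 1].
Proof.
move=> hS; split=> [[fL fP f1]|[fL fP f1]]; split=> //.
- have f1_ge0 := positive_on1 hS fP.
  have f1E : f 1 = (complex.Re `|f 1|)%:C.
    by rewrite ger0_norm // RRe_real // ger0_real.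
  rewrite f1E; congr _%:C; apply/le_anti/andP; split; rewrite -lee_fin.
    rewrite -[leRHS]f1; apply: ereal_sup_ubound; exists 1 => //.
    by split; [exact: csub1 | rewrite nmE nm1].
  rewrite -[leLHS]f1; apply: ge_ereal_sup => _ [x [Sx x1] <-].
  rewrite lee_fin -lecR -f1E RRe_real ?normr_real //.
  by apply: (positive_on_norm hS) => //; rewrite -lecR -nmE.
- apply/le_anti/andP; split.
    apply: ge_ereal_sup => _ [x [Sx x1] <-].
    rewrite lee_fin -lecR RRe_real ?normr_real // rmorph1 -f1.
    by apply: (positive_on_norm hS) => //; rewrite -lecR -nmE.
  apply: ereal_sup_ubound; exists 1; last by rewrite f1 normr1.
  by split; [exact: csub1 | rewrite nmE nm1].
Qed.

Lemma is_state_restrict S f : unital_cstar_subalgebra S ->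
  is_state setT f -> is_state S f.
Proof.
move=> hS /(is_stateP _ unital_cstar_subalgebraT)[fL fP f1].
apply/(is_stateP _ hS); split => // [k x y _ _|x _]; first exact: fL.
exact: fP.
Qed.

Section StateOn.
Variables (S : set A) (f : A -> R[i]).
Hypotheses (hS : unital_cstar_subalgebra S) (fS : is_state S f).

Let fL : linear_on S f. Proof. by case: fS. Qed.
Let fP : positive_on S f. Proof. by case: fS. Qed.
Let f1 : f 1 = 1. Proof. by have /(is_stateP _ hS)[] := fS. Qed.

Lemma state_psd_ge0 p : S p -> psd p -> 0 <= f p.
Proof. exact: positive_on_psd. Qed.

Lemma stateA (k : R[i]) : f k%:A = k.
Proof. by rewrite (linear_onZ hS fL) ?f1 ?mulr1 //; exact: csub1. Qed.

(** The difference comes from [(nm p - p) p], a product of commuting positive elements. *)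
Lemma state_sqr_le p : S p -> psd p -> f (p * p) <= (nm p)%:C * f p.
Proof.
move=> Sp pp; rewrite -subr_ge0 -(linear_onZ hS fL) // -(linear_onB fL) //.
- have -> : (nm p)%:C *: p - p * p = ((nm p)%:C%:A - p) * p.
    by rewrite mulrBl -scalerAl mul1r.
  apply: state_psd_ge0.
    by apply: csubM => //; apply: csubB => //; exact: csubA.
  apply: psdM => //; first exact: psd_ge_nm (psd_sa pp) (lexx _).
  by rewrite mulrBl mulrBr commA.
- exact: csubZ.
- exact: csubM.
Qed.

(** The variance is nonnegative: with [t = f p], the value of [f] at [(p - t)^2] is
    [f (p * p) - t^2]. *)
Lemma state_le_sqrtC p : S p -> psd p -> f p <= sqrtC (f (p * p)).
Proof.
move=> Sp pp; have fp := state_psd_ge0 Sp pp.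
have fpp := state_psd_ge0 (csubM hS Sp Sp) (psd_sq (psd_sa pp)).
rewrite -(@ler_pXn2r _ 2) ?nnegrE ?sqrtC_ge0 // sqrtCK.
set t := complex.Re (f p).
have fpE : f p = t%:C := positive_on_sa hS fL fP Sp (psd_sa pp).
have Sd : S (p - t%:C%:A) by apply: csubB => //; exact: csubA.
have sd : sa (p - t%:C%:A) by apply: saB; [exact: psd_sa | exact: saA].
have := state_psd_ge0 (csubM hS Sd Sd) (psd_sq sd).
have -> : (p - t%:C%:A) * (p - t%:C%:A) =
    p * p - t%:C *: (p + (p - t%:C%:A)).
  rewrite mulrBl !mulrBr commA -!scalerAl !mul1r scalerDr scalerBr.
  by rewrite [in RHS]opprD [in RHS]addrA.
have St : S t%:C%:A by exact: csubA.
have Spt : S (p + (p - t%:C%:A)) by apply: csubD => //; exact: csubB.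
have Sq : S (p - t%:C%:A) by exact: csubB.
rewrite (linear_onB fL (csubM hS Sp Sp) (csubZ hS _ Spt)).
rewrite (linear_onZ hS fL _ Spt).
rewrite (linear_onD fL Sp Sq) (linear_onB fL Sp St) stateA fpE.
by rewrite subrr addr0 subr_ge0 expr2.
Qed.

End StateOn.

(** * Extension of states *)

(* [G] is the graph of a real functional on a real space of self-adjoint
   elements, bounded by the gauge [x |-> inf {t | x <= t 1}]; this bound alone
   makes [G] single-valued. *)
Definition dominated (G : set (A * R)) : Prop :=
  [/\ G (0, 0),
      forall k x r y s, G (x, r) -> G (y, s) -> G (k%:C *: x + y, k * r + s),
      forall x r, G (x, r) -> sa x
    & forall x r t, G (x, r) -> psd (t%:C%:A - x) -> r <= t].

Lemma dominatedZ G k x r : dominated G -> G (x, r) -> G (k%:C *: x, k * r).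
Proof.
by case=> G0 GL _ _ Gx; have := GL k _ _ _ _ Gx G0; rewrite !addr0.
Qed.

Lemma dominated_fun G x r s : dominated G -> G (x, r) -> G (x, s) -> r = s.
Proof.
move=> dG; suff le_rs r' s' : G (x, r') -> G (x, s') -> r' <= s'.
  by move=> Gr Gs; apply/le_anti; rewrite !le_rs.
case: dG => G0 GL Gsa Gle Gr Gs.
have := GL (-1) _ _ _ _ Gs Gr; rewrite rmorphN1 scaleN1r addNr mulN1r addrC.
move=> /Gle -/(_ 0); rewrite subr0 scale0r subr_le0; apply.
exact: psd0.
Qed.

(** The one-dimensional step of Hahn-Banach; [a] may already lie in the domain, since domination
    keeps the graph single-valued. *)
Lemma dominated_adjoin G a : dominated G -> sa a ->
  exists d, dominated [set u | exists x r t,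
    [/\ G (x, r), u.1 = t%:C *: a + x & u.2 = t * d + r]].
Proof.
move=> dG sa_a; have [G0 GL Gsa Gle] := dG.
(* [E] collects the lower bounds that elements [x - a] impose on the value at [a]; [EP] shows that
   each lies below every upper bound imposed by some [x + a]. *)
pose E := [set d | exists x r t,
  [/\ G (x, r), psd (t%:C%:A - (x - a)) & d = r - t]].
have EP x r t d : G (x, r) -> psd (t%:C%:A - (x + a)) -> E d -> d <= t - r.
  move=> Gx px [y [s [t' [Gy py ->]]]].
  have := GL 1 _ _ _ _ Gx Gy; rewrite scale1r mul1r => /Gle-/(_ (t + t')).
  have := psdD px py; rewrite addrACA -scaleCD -opprD addrACA subrr addr0.
  by move=> /[swap]/[apply]; lra.
have E0 : E !=set0.
  exists (- nm a), 0, 0, (nm a); split => //; last by rewrite sub0r.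
  by rewrite sub0r; apply: psd_ge_nm; [exact: saN | rewrite nmN].
have Eub : has_ubound E.
  exists (nm a) => d Ed; rewrite -[nm a]subr0; apply: EP G0 _ Ed.
  by rewrite add0r; apply: psd_ge_nm.
pose c := sup E.
exists c; split.
- by exists 0, 0, 0; split=> //=; rewrite ?scale0r ?mul0r addr0.
- move=> k _ _ _ _ [x [r [t [Gx /= -> ->]]]] [y [s [t' [Gy /= -> ->]]]].
  exists (k%:C *: x + y), (k * r + s), (k * t + t'); split=> /=.
  + exact: GL.
  + by rewrite scalerDr addrACA scaleCA -scaleCD.
  + by ring.
- move=> _ _ [x [r [t [Gx /= -> _]]]].
  by apply: saD; [exact: saZ | exact: Gsa Gx].
move=> _ _ t' [x [r [t [Gx /= -> ->]]]] pt'.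
(* Dividing by the absolute value of [t] leaves [x - a] or [x + a], after rescaling [x]. *)
have [t0|t0|t0] := ltgtP t 0.
- have k0 : 0 < - t^-1 by rewrite oppr_gt0 invr_lt0.
  move: (- t^-1) k0 (mulNr t^-1 t) => k k0; rewrite mulVf ?lt_eqF // => kt.
  have Ed : E (k * r - k * t').
    exists (k%:C *: x), (k * r), (k * t'); split => //; first exact: dominatedZ.
    have := psdZ (ltW k0) pt'; rewrite scalerBr scaleCA scalerDr scaleCA kt.
    by rewrite rmorphN1 scaleN1r [- a + _]addrC.
  have : k * r - k * t' <= c by apply: ub_le_sup.
  have t0' : 0 < - t by rewrite oppr_gt0.
  by rewrite -(ler_pM2l t0') -mulrBr mulrA mulNr [t * k]mulrC kt opprK; lra.
- have it : 0 < t^-1 by rewrite invr_gt0.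
  have : c <= t^-1 * t' - t^-1 * r.
    apply: ge_sup => // d; apply: EP; first exact: dominatedZ Gx.
    have := psdZ (ltW it) pt'.
    rewrite scalerBr scaleCA scalerDr scaleCA mulVf ?gt_eqF //.
    by rewrite scale1r [a + _]addrC.
  rewrite -mulrBr -(ler_pM2l t0) mulrA divff ?gt_eqF //; lra.
- rewrite t0 mul0r add0r; apply: Gle Gx _.
  by move: pt'; rewrite t0 scale0r add0r.
Qed.

(** Zorn's lemma is applied to sets whose union with [G0] is dominated, so that the empty chain
    causes no trouble. *)
Lemma dominated_total G0 : dominated G0 ->
  exists G, [/\ dominated G, G0 `<=` G & forall a, sa a -> exists r, G (a, r)].
Proof.
move=> dG0.
have [|X [dX maxX]] := @Zorn_bigcup _ [set X | dominated (X `|` G0)].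
  move=> F FP Ftot; set U := (\bigcup_(X in F) X) `|` G0.
  (* Each clause of [dominated] involves at most two points of the graph, so it suffices to place
     two points in one dominated subset. *)
  have sub2 u v : U u -> U v -> exists X,
      [/\ dominated X, X `<=` U, X u & X v].
    have FU X : F X -> X `|` G0 `<=` U.
      by move=> FX w [Xw|]; [left; exists X | right].
    have GU : G0 `<=` U by move=> w; right.
    move=> [[X FX Xu]|Gu] [[Y FY Yv]|Gv].
    - have [XY|YX] := Ftot _ _ FX FY.
        by exists (Y `|` G0); split; [exact: FP|exact: FU|left; exact: XY|left].
      by exists (X `|` G0); split; [exact: FP|exact: FU|left|left; exact: YX].
    - by exists (X `|` G0); split; [exact: FP|exact: FU|left|right].
    - by exists (Y `|` G0); split; [exact: FP|exact: FU|right|left].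
    - by exists G0.
  split.
  - by right; case: dG0.
  - by move=> k x r y s Ux Uy; have [X [[_ XL _ _] XU Xx Xy]] := sub2 _ _ Ux Uy;
      apply/XU/XL.
  - by move=> x r Ux; have [X [[_ _ Xsa _] _ Xx _]] := sub2 _ _ Ux Ux;
      exact: Xsa Xx.
  - by move=> x r t Ux; have [X [[_ _ _ Xle] _ Xx _]] := sub2 _ _ Ux Ux;
      exact: Xle Xx.
exists (X `|` G0); split=> [//||a sa_a]; first exact: subsetUr.
have [c dH] := dominated_adjoin dX sa_a.
set H := [set u | _] in dH.
have XH : X `|` G0 `<=` H.
  move=> [x r] Gx; exists x, r, 0; split => //=.
    by rewrite scale0r add0r.
  by rewrite mul0r add0r.
have HX : H `<=` X.
  apply: contrapT => nHX; apply: (maxX H).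
    by split => // u Xu; apply: XH; left.
  suff HG : H `|` G0 = H by rewrite /= HG.
  by apply: setUidl => u Gu; apply: XH; right.
exists c; left; apply: HX; exists 0, 0, 1; split.
- by case: dX.
- by rewrite scale1r addr0.
- by rewrite mul1r addr0.
Qed.

(** The total real functional [g] on self-adjoint elements is complexified through real and
    imaginary parts. *)
Lemma dominated_state G0 : dominated G0 ->
  exists2 f, is_state setT f & forall x r, G0 (x, r) -> f x = r%:C.
Proof.
move=> /dominated_total[G [dG G0G Gtot]]; have [GO GL Gsa Gle] := dG.
have /choice[g gP] : forall a, exists r, sa a -> G (a, r).
  move=> a; have [/Gtot[r Gr]|nsa] := pselect (sa a); first by exists r.
  by exists 0.
have gE x r : G (x, r) -> g x = r.
  by move=> Gx; apply: dominated_fun dG (gP _ (Gsa _ _ Gx)) Gx.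
have gL k x y : sa x -> sa y -> g (k%:C *: x + y) = k * g x + g y.
  by move=> sx sy; apply/gE/GL; apply: gP.
pose re x := (2^-1)%:C *: (x + star x).
pose im x := (- 2^-1)%:C *: ('i%C *: (x - star x)).
have sre x : sa (re x) by apply: saZ; rewrite /sa starD starK addrC.
have sim x : sa (im x).
  by apply: saZ; rewrite /sa starZi starB starK -scalerN opprB.
have re_sa x : sa x -> re x = x.
  by move=> sx; rewrite /re sx -scale2C scaleCA mulVf // scale1r.
have im_sa x : sa x -> im x = 0 by move=> sx; rewrite /im sx subrr !scaler0.
have g0 : g 0 = 0 by exact: gE.
have reD x y : re (x + y) = re x + re y.
  by rewrite /re starD addrACA scalerDr.
have imD x y : im (x + y) = im x + im y.
  by rewrite /im starD opprD addrACA !scalerDr.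
have reZ p x : re (p%:C *: x) = p%:C *: re x.
  by rewrite /re starZR -scalerDr !scaleCA mulrC.
have imZ p x : im (p%:C *: x) = p%:C *: im x.
  have swap v : 'i%C *: (p%:C *: v) = p%:C *: ('i%C *: v).
    by rewrite !scalerA mulrC.
  by rewrite /im starZR -scalerBr swap !scaleCA mulrC.
have rei x : re ('i%C *: x) = - im x.
  by rewrite /re /im starZi -scalerBr rmorphN scaleNr opprK.
have imi x : im ('i%C *: x) = re x.
  rewrite /im starZi opprK -scalerDr [_ *: (_ *: (_ + _))]scalerA mulii.
  by rewrite scaleN1r scalerN rmorphN scaleNr opprK.
have splitZ p q x : (p +i* q) *: x = p%:C *: x + q%:C *: ('i%C *: x).
  by rewrite scalerA -scalerDl mulrC [p +i* q]complexE.
have reL p q x y : re ((p +i* q) *: x + y) =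
    p%:C *: re x + ((- q)%:C *: im x + re y).
  by rewrite splitZ !reD !reZ rei rmorphN scaleNr scalerN addrA.
have imL p q x y : im ((p +i* q) *: x + y) =
    p%:C *: im x + (q%:C *: re x + im y).
  by rewrite splitZ !imD !imZ imi addrA.
pose f x : R[i] := g (re x) +i* g (im x).
have f_sa x : sa x -> f x = (g x)%:C.
  by move=> sx; rewrite /f re_sa // im_sa // g0.
exists f; last first.
  by move=> x r /G0G Gx; rewrite f_sa ?(gE _ _ Gx) //; exact: Gsa Gx.
apply/(is_stateP _ unital_cstar_subalgebraT); split.
- move=> [p q] x y _ _; rewrite /f reL imL !gL //; last 2 first.
  + by apply: saD => //; exact: saZ.
  + by apply: saD => //; exact: saZ.
  by apply/eqP; rewrite eq_complex /=; apply/andP; split; apply/eqP; ring.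
(* Positivity is domination of [- star x * x] by [0]. *)
- move=> x _; have sx := sa_starM x; rewrite f_sa // ler0c.
  have := dominatedZ (-1) dG (gP _ sx); rewrite rmorphN1 scaleN1r mulN1r.
  move=> /Gle -/(_ 0); rewrite oppr_le0; apply.
  by rewrite scale0r sub0r opprK; exact: psd_star_mul.
(* Domination at [1] and at [-1] pins the value to [1]. *)
- have s1 := sa1; rewrite f_sa //; congr _%:C.
  apply/le_anti/andP; split.
    by apply: Gle (gP _ s1) _; rewrite scale1r subrr; exact: psd0.
  have := dominatedZ (-1) dG (gP _ s1); rewrite rmorphN1 scaleN1r mulN1r.
  move=> /Gle -/(_ (-1)); rewrite lerN2; apply.
  by rewrite rmorphN1 scaleN1r subrr; exact: psd0.
Qed.

(* [mu] is the maximum of the spectrum of [a]. *)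
Lemma state_attains_max a : sa a ->
  exists mu f, [/\ psd (mu%:C%:A - a), is_state setT f & f a = mu%:C].
Proof.
move=> sa_a; pose E := [set t | psd (t%:C%:A - a)].
have E0 : E !=set0 by exists (nm a); apply: psd_ge_nm.
have Elb : has_lbound E.
  exists (- nm a) => t /= pt; have := psdD pt (psd_ge_nm (saN sa_a) (lexx _)).
  by rewrite addrACA nmN -scaleCD subrr addr0 => /psdA_ge0; lra.
have Einf : has_inf E by split.
pose mu := inf E; pose b := mu%:C%:A - a.
have sb : sa b by apply: saB => //; exact: saA.
(* The infimum belongs to [E] because positive elements are closed under limits of small shifts. *)
have pb : psd b.
  apply: psd_closed => // e e0; rewrite /b addrAC -scaleCD.
  have [t /= pt lt_t] := inf_adherent e0 Einf.
  have -> : (mu + e)%:C%:A - a = (mu + e - t)%:C%:A + (t%:C%:A - a).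
    by rewrite addrA -scaleCD subrK.
  by apply: psdD => //; apply: psdA; rewrite subr_ge0 ltW.
(* The zero functional on the real line through [b = mu - a]; a state extending it vanishes at
   [b]. *)
pose G := [set u : A * R | exists t, u.1 = t%:C *: b /\ u.2 = 0].
have dG : dominated G.
  split.
  - by exists 0; split=> //=; rewrite scale0r.
  - move=> k _ _ _ _ [t [/= -> ->]] [s [/= -> ->]]; exists (k * t + s).
    by split=> /=; [rewrite scaleCA -scaleCD | rewrite mulr0 addr0].
  - by move=> _ _ [t [/= -> _]]; exact: saZ.
  - move=> _ _ t [s [/= -> ->]] pt; have [s0|s0] := leP 0 s.
      by apply: psdA_ge0; have := psdD pt (psdZ s0 pb); rewrite subrK.
    (* For [s < 0], a bound [s b <= t] with [t < 0] would put a number below [mu] into [E]. *)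
    rewrite leNgt; apply/negP => t0.
    have k0 : 0 < - s^-1 by rewrite oppr_gt0 invr_lt0.
    move: (- s^-1) k0 (mulNr s^-1 s) => k k0; rewrite mulVf ?lt_eqF // => ks.
    have : E (mu + k * t).
      have := psdZ (ltW k0) pt; rewrite scalerBr !scaleCA ks.
      rewrite rmorphN1 scaleN1r opprK /b addrA -scaleCD.
      by rewrite [_ + mu]addrC.
    move=> /(ge_inf Elb); rewrite -/mu lerDl; apply/negP; rewrite -ltNge.
    by rewrite pmulr_rlt0.
have [f fS fG] := dominated_state dG; exists mu, f; split => //.
have [fL _ _] := fS; have hT := unital_cstar_subalgebraT.
have : f b = 0 by apply: (fG _ 0); exists 1; rewrite scale1r.
rewrite (linear_onB fL) // (stateA hT fS) => /eqP.
by rewrite subr_eq0 => /eqP.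
Qed.

(** * Left kernels and independence *)

Lemma left_kernel_abs_bounds S (f g : A -> R[i]) (m M : R) :
    unital_cstar_subalgebra S -> is_state S f -> is_state S g -> 0 < m ->
    (forall x, S x -> m%:C * g (cstar_abs x) <= f (cstar_abs x)
                                   <= M%:C * sqrtC (g (cstar_abs x ^+ 2))) ->
  left_kernel S f = left_kernel S g.
Proof.
move=> hS fS gS m0 bnd; apply/seteqP; split=> x [Sx x0]; split=> //.
(* Vanishing passes from [f] at the square of the absolute value to [f] at the absolute value, then
   by the lower bound to [g] there, then to [g] at the square. *)
- have [Sp pp ppE] := cstar_absP hS Sx; have /andP[le_mg _] := bnd x Sx.
  have f_le0 : f (cstar_abs x) <= 0.
    by have := state_le_sqrtC hS fS Sp pp; rewrite ppE x0 sqrtC0.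
  have g0 : g (cstar_abs x) = 0.
    apply/le_anti; rewrite (state_psd_ge0 hS gS) // andbT.
    by rewrite -(@pmulr_rle0 _ m%:C) ?ltcR // (le_trans le_mg).
  apply/le_anti; rewrite -ppE; apply/andP; split.
    by have := state_sqr_le hS gS Sp pp; rewrite g0 mulr0.
  by apply: (state_psd_ge0 hS gS); [exact: csubM | exact: psd_sq (psd_sa pp)].
(* Here the upper bound starts directly from the vanishing of [g] at the square. *)
- have [Sp pp ppE] := cstar_absP hS Sx; have /andP[_ le_fM] := bnd x Sx.
  have f0 : f (cstar_abs x) = 0.
    apply/le_anti; rewrite (state_psd_ge0 hS fS) // andbT.
    by move: le_fM; rewrite expr2 ppE x0 sqrtC0 mulr0.
  apply/le_anti; rewrite -ppE; apply/andP; split.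
    by have := state_sqr_le hS fS Sp pp; rewrite f0 mulr0.
  by apply: (state_psd_ge0 hS fS); [exact: csubM | exact: psd_sq (psd_sa pp)].
Qed.

Lemma left_kernel_max S (f g : A -> R[i]) a (mu : R) :
    unital_cstar_subalgebra S -> is_state S f -> is_state S g ->
    left_kernel S f = left_kernel S g -> S a -> psd (mu%:C%:A - a) ->
  g a = mu%:C -> f a = mu%:C.
Proof.
move=> hS fS gS fg Sa pa ga.
have [fL _ _] := fS; have [gL _ _] := gS; have Smu := csubA hS mu%:C.
have [z [Sz [sz _] zz _]] := psd_sqrt hS (csubB hS Smu Sa) pa.
have : left_kernel S g z.
  split => //; rewrite sz zz (linear_onB gL) // (stateA hS gS) ga subrr //.
rewrite -fg => -[_]; rewrite sz zz (linear_onB fL) // (stateA hS fS) => /eqP.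
by rewrite subr_eq0 => /eqP.
Qed.

Lemma left_kernels_cstar_independent (A1 A2 : set A) :
    unital_cstar_subalgebra A1 -> unital_cstar_subalgebra A2 ->
    (forall f1 f2 : A -> R[i], is_state A1 f1 -> is_state A2 f2 ->
       exists f : A -> R[i], [/\ is_state setT f,
         left_kernel A1 f = left_kernel A1 f1
         & left_kernel A2 f = left_kernel A2 f2]) ->
  cstar_independent A1 A2.
Proof.
move=> hA1 hA2 lk f1 f2 f1S f2S; have hT := unital_cstar_subalgebraT.
have [[f1L f1P _] [f2L f2P _]] := (f1S, f2S).
have f1R := positive_on_sa hA1 f1L f1P; have f2R := positive_on_sa hA2 f2L f2P.
(* A relation rather than a function, since [a + b] does not determine [a] and [b]; consistency will
   follow from domination. *)
pose G := [set u : A * R | exists a b, [/\ A1 a /\ sa a, A2 b /\ sa b,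
  u.1 = a + b & u.2 = complex.Re (f1 a) + complex.Re (f2 b)]].
have ReD S (h : A -> R[i]) : unital_cstar_subalgebra S -> linear_on S h ->
    forall k x y, S x -> S y ->
    complex.Re (h (k%:C *: x + y)) = k * complex.Re (h x) + complex.Re (h y).
  move=> hS hL k x y Sx Sy; rewrite hL // raddfD /=; congr (_ + _).
  by case: (h x) => u v /=; rewrite mul0r subr0.
have Re_le S (h : A -> R[i]) a mu : unital_cstar_subalgebra S ->
    is_state S h -> S a -> psd (mu%:C%:A - a) -> complex.Re (h a) <= mu.
  move=> hS hSt Sa pa; have [hL _ _] := hSt; have Smu := csubA hS mu%:C.
  have := state_psd_ge0 hS hSt (csubB hS Smu Sa) pa.
  rewrite (linear_onB hL) // (stateA hS hSt) subr_ge0 lecE /=.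
  by case/andP.
have dG : dominated G.
  split.
  - exists 0, 0; split; rewrite ?addr0 //=.
    + by split; [exact: csub0 | exact: sa0].
    + by split; [exact: csub0 | exact: sa0].
    + by rewrite (linear_on0 hA1 f1L) (linear_on0 hA2 f2L) addr0.
  - move=> k _ _ _ _ [a [b [[Sa sa_a] [Sb sb] /= -> ->]]]
      [a' [b' [[Sa' sa'] [Sb' sb'] /= -> ->]]].
    exists (k%:C *: a + a'), (k%:C *: b + b'); split => /=.
    + by split; [exact: csubL | apply: saD => //; exact: saZ].
    + by split; [exact: csubL | apply: saD => //; exact: saZ].
    + by rewrite scalerDr addrACA.
    + by rewrite (ReD _ _ hA1) // (ReD _ _ hA2) //; ring.
  - by move=> _ _ [a [b [[_ sa_a] [_ sb] /= -> _]]]; exact: saD.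
  - move=> _ _ t [a [b [[Sa sa_a] [Sb sb] /= -> ->]]] pt.
    have [mu [g1 [pmu g1S g1a]]] := state_attains_max sa_a.
    have [nu [g2 [pnu g2S g2b]]] := state_attains_max sb.
    have g1S1 := is_state_restrict hA1 g1S.
    have g2S2 := is_state_restrict hA2 g2S.
    have [f [fS lk1 lk2]] := lk _ _ g1S1 g2S2; have [fL _ _] := fS.
    have fa : f a = mu%:C.
      exact: left_kernel_max hA1 (is_state_restrict hA1 fS) g1S1 lk1 Sa pmu g1a.
    have fb : f b = nu%:C.
      exact: left_kernel_max hA2 (is_state_restrict hA2 fS) g2S2 lk2 Sb pnu g2b.
    have := Re_le _ _ _ _ hT fS I pt; rewrite (linear_onD fL) // fa fb /=.
    have := Re_le _ _ _ _ hA1 f1S Sa pmu; have := Re_le _ _ _ _ hA2 f2S Sb pnu.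
    by lra.
have [f fS fG] := dominated_state dG; have [fL _ _] := fS.
(* Agreement on self-adjoint elements suffices, as [x] is half of [(x + star x) - i v] with [v]
   self-adjoint. *)
have ext S (h : A -> R[i]) : unital_cstar_subalgebra S -> linear_on S h ->
    (forall a, S a -> sa a -> f a = h a) -> {in S, f =1 h}.
  move=> hS hL fh x /set_mem Sx; have Sx' := csub_star hS Sx.
  pose v := 'i%C *: (x - star x).
  have Su : S (x + star x) by exact: csubD.
  have Sv : S v by apply: csubZ => //; exact: csubB.
  have xE : x = (2^-1)%:C *: ((x + star x) + (- 'i%C) *: v).
    rewrite /v scalerA mulNr mulii opprK scale1r addrACA subrr addr0.
    by rewrite -scale2C scaleCA mulVf // scale1r.
  have SNv : S (- 'i%C *: v) by exact: csubZ.
  have hu : f (x + star x) = h (x + star x).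
    by apply: fh => //; rewrite /sa starD starK addrC.
  have hv : f v = h v.
    by apply: fh => //; rewrite /sa starZi starB starK -scalerN opprB.
  rewrite xE (linear_onZ hS hL _ (csubD hS Su SNv)) (linear_onZ hT fL) //.
  rewrite (linear_onD hL Su SNv) (linear_onD fL) // hu.
  by rewrite (linear_onZ hS hL _ Sv) (linear_onZ hT fL) // hv.
exists f; split => //.
- apply: ext => // a Sa sa_a; rewrite f1R //; apply: fG.
  exists a, 0; split => //=; rewrite ?addr0 //.
    by split; [exact: csub0 | exact: sa0].
  by rewrite (linear_on0 hA2 f2L) /= addr0.
- apply: ext => // b Sb sb; rewrite f2R //; apply: fG.
  exists 0, b; split => //=; rewrite ?add0r //.
    by split; [exact: csub0 | exact: sa0].
  by rewrite (linear_on0 hA1 f1L) /= add0r.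
Qed.

End CStarAlgebraStates.

Theorem corollary2p4 (R : realType) (A : cstarAlgType R) (A1 A2 : set A)
    (hA1 : unital_cstar_subalgebra A1) (hA2 : unital_cstar_subalgebra A2) :
  [<-> module_independent A1 A2;
       forall f1 f2 : A -> R[i], is_state A1 f1 -> is_state A2 f2 ->
         exists f : A -> R[i],
           [/\ is_state setT f,
               left_kernel A1 f = left_kernel A1 f1
             & left_kernel A2 f = left_kernel A2 f2];
       cstar_independent A1 A2].
Proof.
tfae.
- move=> [m [M [m0 _ mi]]] f1 f2 f1S f2S.
  have [f [fS b1 b2]] := mi f1 f2 f1S f2S; exists f; split => //.
  + exact: left_kernel_abs_bounds hA1 (is_state_restrict hA1 fS) f1S m0 b1.
  + exact: left_kernel_abs_bounds hA2 (is_state_restrict hA2 fS) f2S m0 b2.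
- exact: left_kernels_cstar_independent.
(* An extension agrees with the given state at [cstar_abs x], which lies in the subalgebra: the
   lower bound is an equality and the upper one is [state_le_sqrtC]. *)
- move=> ci; exists 1, 1; split=> // f1 f2 f1S f2S.
  have [f [fS ff1 ff2]] := ci f1 f2 f1S f2S; exists f; split => // x Sx.
  + have [Sp pp _] := cstar_absP hA1 Sx.
    by rewrite !mul1r ff1 ?inE // lexx expr2 (state_le_sqrtC hA1).
  + have [Sp pp _] := cstar_absP hA2 Sx.
    by rewrite !mul1r ff2 ?inE // lexx expr2 (state_le_sqrtC hA2).
Qed.
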